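(* Let $a\in L_1(0,2\pi)$ be real-valued with flux $\alpha=\frac1{2\pi}\int_0^{2\pi}a\,dx\notin\mathbb Z$. Let $\{\phi_n\}_{n=1}^N$ be $2\pi$-periodic vector-functions $\phi_n=(\phi_n(\cdot,1),\dots,\phi_n(\cdot,M))^T$ orthonormal in $L_2(0,2\pi;\mathbb C^M)$ (no zero-average condition), and $U(x,y)=\sum_{n=1}^N\phi_n(x)\overline{\phi_n(y)}^T$. Then $$\int_0^{2\pi}\operatorname{Tr}[U(x,x)^3]dx\le K(\alpha)^2\sum_{n=1}^N\sum_{j=1}^M\int_0^{2\pi}|(i\partial_x-a(x))\phi_n(x,j)|^2dx,$$ where $K(\alpha)=|\sin(2\pi\alpha)|^{-1}$ if $\alpha\bmod1\in(0,1/4)\cup(3/4,1)$ and $K(\alpha)=1$ if $\alpha\bmod1\in[1/4,3/4]$. *)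

(* Defs.v *)
From HB Require Import structures.
From mathcomp Require Import all_boot all_order all_algebra.
From mathcomp Require Import all_classical all_reals all_analysis.
From mathcomp Require Import complex.
Set Implicit Arguments. Unset Strict Implicit. Unset Printing Implicit Defensive.
Import Order.TTheory GRing.Theory Num.Theory.
Import numFieldNormedType.Exports.
Local Open Scope classical_set_scope.
Local Open Scope ring_scope.

Definition per_int (R : realType) : set R := `[0, 2 * pi]%classic.

Definition int_re (R : realType) (f : R -> complex R) : \bar R :=
  (\int[lebesgue_measure]_(x in @per_int R) (complex.Re (f x))%:E)%E.
Definition int_im (R : realType) (f : R -> complex R) : \bar R :=
  (\int[lebesgue_measure]_(x in @per_int R) (complex.Im (f x))%:E)%E.

Definition c_integrable (R : realType) (f : R -> complex R) : Prop :=
  (@lebesgue_measure R).-integrable (@per_int R) (fun x => (complex.Re (f x))%:E) /\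
  (@lebesgue_measure R).-integrable (@per_int R) (fun x => (complex.Im (f x))%:E).

Definition seg (R : realType) (x : R) : set R := `[0, x]%classic.

Definition c_prim (R : realType) (f : R -> complex R) (x : R) : complex R :=
  Complex (fine (\int[lebesgue_measure]_(t in seg x) (complex.Re (f t))%:E)%E)
          (fine (\int[lebesgue_measure]_(t in seg x) (complex.Im (f t))%:E)%E).

(** phi is absolutely continuous on [0, 2 pi] with (a.e.) derivative dphi:
    dphi is integrable and phi x = phi 0 + \int_0^x dphi for x in [0, 2 pi]. *)
Definition AC_with_deriv (R : realType) (phi dphi : R -> complex R) : Prop :=
  c_integrable dphi /\
  forall x, 0 <= x <= 2 * pi -> phi x = phi 0 + c_prim dphi x.

Definition periodic2pi (R : realType) (T : Type) (f : R -> T) : Prop :=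
  forall x, f (x + 2 * pi) = f x.

Definition flux (R : realType) (a : R -> R) : R :=
  (2 * pi)^-1 * fine (\int[lebesgue_measure]_(x in @per_int R) (a x)%:E)%E.

Definition frac1 (R : realType) (x : R) : R := x - (Num.floor x)%:~R.

Definition Kconst (R : realType) (alpha : R) : R :=
  if (1 / 4 <= frac1 alpha <= 3 / 4) then 1 else `|sin (2 * pi * alpha)|^-1.

Definition Umat (R : realType) (N M : nat) (phi : 'I_N -> 'I_M -> R -> complex R)
  (x : R) : 'M[complex R]_M :=
  \matrix_(j, k) \sum_(n < N) phi n j x * conjc (phi n k x).

Definition cabs2 (R : realType) (z : complex R) : R :=
  complex.Re z ^+ 2 + complex.Im z ^+ 2.

(* Main.v *)
(** The gauge transformation v = e^(iA) u, where A' = a, turns |(i d/dx - a) u| into |v'| and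
    the periodicity of u into v(2 pi) = e^(2 pi i alpha) v(0).  For l > 0 the energy
    int |v'|^2 + l^2 |v|^2 on a segment with prescribed end values is minimized by combinations
    of e^(l t) and e^(- l t).  Applying this on [0, x] and on [x, 2 pi], and minimizing over
    v(0), gives with T = 2 pi l
      2 l |u(x)|^2 (cosh T - cos(2 pi alpha)) / sinh T <= int |(i d/dx - a) u|^2 + l^2 |u|^2,
    and (cosh T - cos(2 pi alpha)) / sinh T >= 1 / K(alpha) for all T > 0.

    For u = sum_n v_n phi_n this bounds the Gram matrix G(x) of the rows (phi_n(x, j))_j by
      2 l <v, G(x) v> <= K (<v, A v> + l^2 <v, v>)   for all l > 0,
    where A is the Gram matrix of the functions (i d/dx - a) phi_n in L_2.  Taking for v a unit
    eigenvector of G(x) with eigenvalue d and l = d / K gives d^3 <= K^2 d <v, A v>; summing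
    over an eigenbasis, Tr U(x, x)^3 = Tr G(x)^3 <= K^2 Tr (G(x) A).  Orthonormality says that
    G integrates to the identity, and Tr A is the right-hand side of the theorem. *)
Require Import Defs.
From HB Require Import structures.
From mathcomp Require Import all_boot all_order all_algebra.
From mathcomp Require Import all_classical all_reals all_analysis.
From mathcomp Require Import complex.
From mathcomp Require Import spectral sesquilinear measurable_realfun ring lra.
Import Order.TTheory GRing.Theory Num.Theory.
Import numFieldNormedType.Exports.
Local Open Scope classical_set_scope.
Local Open Scope ring_scope.

Set Implicit Arguments. Unset Strict Implicit. Unset Printing Implicit Defensive.

(** * Absolutely continuous functions *)

(* The real counterpart of [AC_with_deriv], on [0, L]. *)
Definition ac (R : realType) (L : R) (f df : R -> R) : Prop :=
  (@lebesgue_measure R).-integrable `[0, L] (EFin \o df) /\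
  forall x : R, 0 <= x <= L -> f x = f 0 + \int[@lebesgue_measure R]_(t in `[0, x]) df t.

(** * Integrability of linear combinations and bounded multiples *)

Section RealIntegrable.
Context d (T : measurableType d) (R : realType) (mu : {measure set T -> \bar R}).
Context (D : set T) (mD : measurable D).
Implicit Types (g h : T -> R) (c : R).

Lemma integrable_scale c h :
  mu.-integrable D (EFin \o h) -> mu.-integrable D (EFin \o (fun x => c * h x)).
Proof.
by move=> ih; apply: eq_integrable (integrableZl mD c ih) => // x _; rewrite /= EFinM.
Qed.

Lemma integrable_add g h :
  mu.-integrable D (EFin \o g) -> mu.-integrable D (EFin \o h) ->
  mu.-integrable D (EFin \o (fun x => g x + h x)).
Proof.
by move=> ig ih; apply: eq_integrable (integrableD mD ig ih) => // x _; rewrite /= EFinD.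
Qed.

Lemma integrable_sub g h :
  mu.-integrable D (EFin \o g) -> mu.-integrable D (EFin \o h) ->
  mu.-integrable D (EFin \o (fun x => g x - h x)).
Proof.
by move=> ig ih; apply: eq_integrable (integrableB mD ig ih) => // x _; rewrite /= EFinB.
Qed.

Lemma integrable_mul_bounded h (k : T -> R) (B : R) :
  mu.-integrable D (EFin \o h) -> measurable_fun D k ->
  (forall x, D x -> `|k x| <= B) ->
  mu.-integrable D (EFin \o (fun x => h x * k x)).
Proof.
move=> ih mk kB.
apply: eq_integrable (integrableMl mD ih mk _) => //.
apply: filterS (nbhs_pinfty_ge (num_real B)) => M BM x Dx.
exact: le_trans (kB x Dx) _.
Qed.

End RealIntegrable.

(** * Increments, continuity and linearity of absolutely continuous functions *)

Section AbsolutelyContinuous.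
Context {R : realType}.
Notation mu := (@lebesgue_measure R).
Implicit Types (f g h df dg : R -> R) (L s t x : R).

Lemma integrable_cst_itv s t (c : R) : mu.-integrable `[s, t] (EFin \o cst c).
Proof.
apply: measurable_bounded_integrable => //.
- by rewrite [X in (X < _)%E]lebesgue_measure_itv/=; case: ifP => //= _; rewrite -EFinB ltry.
- by apply: filterS (nbhs_pinfty_ge (num_real `|c|)) => M cM x _.
Qed.

Lemma integrable_subitv L h s t : 0 <= s -> t <= L ->
  mu.-integrable `[0, L] (EFin \o h) -> mu.-integrable `[s, t] (EFin \o h).
Proof.
move=> s0 tL; apply: integrableS => //.
by apply: subset_itv; rewrite bnd_simp.
Qed.

Lemma Rintegral_cat h s t u : s <= t -> t <= u ->
  mu.-integrable `[s, u] (EFin \o h) ->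
  \int[mu]_(x in `[s, u]) h x
  = \int[mu]_(x in `[s, t]) h x + \int[mu]_(x in `[t, u]) h x.
Proof.
move=> st tu ih.
have := Rintegral_itvB ih (x := t).
rewrite !bnd_simp => /(_ st tu) E.
rewrite -(subrK (\int[mu]_(x in `[s, t]) h x) (\int[mu]_(x in `[s, u]) h x)) E.
rewrite Rintegral_itv_obnd_cbnd 1?addrC//.
by apply: integrableS ih => //; apply: subset_itv; rewrite bnd_simp.
Qed.

Lemma ac_increment L f df s t : ac L f df -> 0 <= s -> s <= t -> t <= L ->
  f t - f s = \int[mu]_(x in `[s, t]) df x.
Proof.
move=> [idf E] s0 st tL.
rewrite (E t) ?(E s) ?s0 ?(le_trans st)// ?(le_trans s0)//.
rewrite (Rintegral_cat (t := s) (u := t))//; first by ring.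
exact: integrable_subitv idf.
Qed.

Lemma le_Rintegral_normM h (k : R -> R) s t (C : R) :
  mu.-integrable `[s, t] (EFin \o h) -> mu.-integrable `[s, t] (EFin \o k) ->
  (forall x, s <= x <= t -> `|h x| <= C * k x) ->
  `|\int[mu]_(x in `[s, t]) h x| <= C * \int[mu]_(x in `[s, t]) k x.
Proof.
move=> ih ik hC; apply: le_trans (le_normr_Rintegral _ ih) _ => //.
rewrite -RintegralZl//.
apply: le_Rintegral => //.
- exact: integrable_norm.
- exact: integrable_scale.
Qed.

(* The mesh sums of the increments of F are at most eps times the integral of k. *)
Lemma constant_of_small_increments L (F k : R -> R) :
  mu.-integrable `[0, L] (EFin \o k) ->
  (forall e : R, 0 < e -> exists2 d : R, 0 < d & forall s t, 0 <= s -> s <= t ->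
     t <= L -> t - s < d -> `|F t - F s| <= e * \int[mu]_(x in `[s, t]) k x) ->
  forall x, 0 <= x <= L -> F x = F 0.
Proof.
move=> ik small x /andP[x0 xL].
(* An increment bounded by every positive multiple of a fixed integral vanishes; [I + 1] avoids a
   division by zero when that integral is 0. *)
suff bnd (e : R) : 0 < e -> `|F x - F 0| <= e * `|\int[mu]_(x in `[0, x]) k x|.
  apply/eqP; rewrite -subr_eq0 -normr_le0; apply/ler_addgt0Pl => e e0.
  set I : R := `|\int[mu]_(x in `[0, x]) k x| in bnd.
  have I0 : 0 < I + 1 by rewrite ltr_wpDl// normr_ge0.
  apply: le_trans (bnd (e / (I + 1)) _) _; first by rewrite divr_gt0.
  rewrite addr0 -mulrA ler_piMr ?(ltW e0)// mulrC ler_pdivrMr// mul1r lerDl//.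
move=> e0; have [d d0 Hd] := small e e0.
(* This [n] exceeds [x / d], so cutting [0, x] into [n] equal pieces gives a mesh below [d]. *)
pose n := (Num.truncn (x / d)).+1.
have n0 : (0 : R) < n%:R by rewrite ltr0n.
have xn : x / n%:R < d.
  rewrite ltr_pdivrMr// mulrC -ltr_pdivrMr//; exact: truncnS_gt.
have main j : (j <= n)%N ->
   `|F (x * j%:R / n%:R) - F 0| <= e * \int[mu]_(x in `[0, x * j%:R / n%:R]) k x.
  elim: j => [_|j IH jn].
    by rewrite mulr0 mul0r subrr normr0 set_itv1 Rintegral_set1 mulr0.
  have p0 : 0 <= x * j%:R / n%:R by rewrite divr_ge0 ?mulr_ge0// ltW.
  have pq : x * j%:R / n%:R <= x * j.+1%:R / n%:R.
    by rewrite ler_pM2r ?invr_gt0// ler_wpM2l// ler_nat.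
  have qL : x * j.+1%:R / n%:R <= L.
    apply: le_trans xL; rewrite ler_pdivrMr//; apply: ler_wpM2l => //.
    by rewrite ler_nat.
  rewrite (Rintegral_cat p0 pq); last exact: integrable_subitv ik.
  rewrite mulrDr.
  rewrite -(subrK (F (x * j%:R / n%:R)) (F (x * j.+1%:R / n%:R))) -addrA addrC.
  apply: le_trans (ler_normD _ _) _; apply: lerD; first exact/IH/ltnW.
  apply: Hd => //.
  by rewrite -mulrBl -mulrBr -natrB// subSnn mulr1.
have := main n (leqnn n); rewrite mulfK ?gt_eqF// => /le_trans; apply.
by rewrite ler_pM2l// ler_norm.
Qed.

Lemma ac_bounded L f df : ac L f df ->
  exists2 B : R, 0 <= B & forall x, 0 <= x <= L -> `|f x| <= B.
Proof.
move=> [idf E]; exists (`|f 0| + \int[mu]_(x in `[0, L]) `|df x|).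
  by rewrite addr_ge0// Rintegral_ge0.
move=> x /[dup] x0L /andP[x0 xL]; rewrite E//.
apply: le_trans (ler_normD _ _) _; apply: lerD => //.
have ix := integrable_subitv (lexx 0) xL idf.
apply: le_trans (le_normr_Rintegral _ ix) _ => //.
have inn := integrable_norm idf.
rewrite (Rintegral_cat x0 xL inn) lerDl.
by apply: Rintegral_ge0 => y _; exact: normr_ge0.
Qed.

(** Absolute continuity of the integral: |df| has a small integral over every set of small measure.
    The library form lives on the whole line, so [df] is extended by zero outside [0, L]. *)
Lemma ac_modulus L f df : ac L f df -> forall e : R, 0 < e ->
  exists2 d : R, 0 < d & forall s t, 0 <= s -> s <= t -> t <= L -> t - s < d ->
    `|f t - f s| <= e.
Proof.
move=> fac e e0.
have iT : mu.-integrable setT (EFin \o (df \_ `[0, L])).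
  by rewrite -restrict_EFin; apply/integrable_restrict => //; rewrite setTI; case: fac.
have [d [d0 Hd]] := integral_normr_continuous iT e0.
exists d => // s t s0 st tL std.
rewrite (ac_increment fac s0 st tL).
have ist : mu.-integrable `[s, t] (EFin \o df).
  exact: integrable_subitv (fac.1).
apply: le_trans (le_normr_Rintegral _ ist) _ => //.
have -> : \int[mu]_(x in `[s, t]) `|df x| = \int[mu]_(x in `[s, t]) `|(df \_ `[0, L]) x|.
  apply: eq_Rintegral => x; rewrite inE/= in_itv/= => /andP[sx xt].
  by rewrite patchE mem_set//= in_itv/= (le_trans s0 sx) (le_trans xt tL).
have : (mu `[s, t]%classic < d%:E)%E.
  rewrite lebesgue_measure_itv/=; case: ifP => _; last by rewrite lte_fin.
  by rewrite -EFinB lte_fin.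
move=> /(Hd `[s, t]%classic (measurable_itv _)) I.
exact: ltW.
Qed.

(** On [0, L] the function agrees with a constant plus an indefinite integral, which is
    continuous. *)
Lemma ac_measurable L f df : 0 <= L -> ac L f df -> measurable_fun `[0, L] f.
Proof.
move=> L0 fac.
apply: (@eq_measurable_fun _ _ _ _ _
  (fun x => f 0 + parameterized_integral mu 0 x df)).
  by move=> x; rewrite inE/= in_itv/= => x0L; rewrite (fac.2 x x0L).
apply: subspace_continuous_measurable_fun => // x.
apply: cvgD; first exact: cvg_cst.
exact: (parameterized_integral_continuous L0 fac.1).
Qed.

Lemma integrable_mul_ac L h f df : 0 <= L ->
  mu.-integrable `[0, L] (EFin \o h) -> ac L f df ->
  mu.-integrable `[0, L] (EFin \o (fun x => h x * f x)).
Proof.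
move=> L0 ih fac; have [B _ HB] := ac_bounded fac.
apply: (integrable_mul_bounded _ (B := B)) ih (ac_measurable L0 fac) _ => //.
Qed.

Lemma integrable_ac L f df : 0 <= L -> ac L f df ->
  mu.-integrable `[0, L] (EFin \o f).
Proof.
move=> L0 fac.
have i1 : mu.-integrable `[0, L] (EFin \o cst (1 : R)).
  exact: integrable_cst_itv.
apply: eq_integrable (integrable_mul_ac L0 i1 fac) => // x _.
by rewrite /= mul1r.
Qed.

Lemma ac_ext L f g df dg : ac L f df ->
  (forall x, 0 <= x <= L -> f x = g x) -> (forall x, 0 <= x <= L -> df x = dg x) ->
  ac L g dg.
Proof.
move=> [i E] fg dfg; split.
  apply: eq_integrable i => // x; rewrite inE/= in_itv/= => /dfg.
  by move=> ->.
move=> x /[dup] x0L /andP[x0 xL]; rewrite -fg// E// -(fg 0) ?lexx ?(le_trans x0)//.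
congr (_ + _); apply: eq_Rintegral => y; rewrite inE/= in_itv/= => /andP[y0 yx].
by rewrite dfg// y0 (le_trans yx).
Qed.

Lemma ac_lin L (a b : R) f g df dg : ac L f df -> ac L g dg ->
  ac L (fun x => a * f x + b * g x) (fun x => a * df x + b * dg x).
Proof.
move=> [i E] [i' E'].
have ia : mu.-integrable `[0, L] (EFin \o (fun x => a * df x)).
  exact: integrable_scale.
have ib : mu.-integrable `[0, L] (EFin \o (fun x => b * dg x)).
  exact: integrable_scale.
split; first exact: integrable_add.
move=> x /[dup] x0L /andP[x0 xL]; rewrite E// E'//.
have sub h := @integrable_subitv L h 0 x (lexx _) xL.
rewrite RintegralD//; [|exact: sub|exact: sub].
rewrite !RintegralZl//; [by ring|exact: sub|exact: sub].
Qed.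

Lemma ac_cst L (c : R) : ac L (fun=> c) (fun=> 0).
Proof.
split; last by move=> x _; rewrite Rintegral_cst// mul0r addr0.
exact: integrable0.
Qed.

Lemma ac_id L : ac L id (fun=> 1).
Proof.
split; first exact: integrable_cst_itv.
move=> x /andP[x0 xL]; rewrite Rintegral_cst//= lebesgue_measure_itv/= lte_fin.
case: ltrP => /= H; rewrite ?mul1r ?add0r ?oppr0 ?addr0//.
by apply/le_anti; rewrite H x0.
Qed.

(** * Chain rule and product rule *)

Lemma increment_le (h dh : R -> R) (B C u v : R) :
  (forall y : R, is_derive y 1 h (dh y)) -> (forall y : R, `|y| <= B -> `|dh y| <= C) ->
  `|u| <= B -> `|v| <= B -> `|h u - h v| <= C * `|u - v|.
Proof.
move=> hd hC.
wlog vu : u v / v <= u => [wl uB vB|uB vB].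
  have [vu|/ltW uv] := leP v u; first exact: wl.
  by rewrite distrC [`|u - v|]distrC; exact: wl.
have hc : {within `[v, u], continuous h}.
  by apply: derivable_within_continuous => y _; case: (hd y).
have [c + ->] := MVT_segment vu (fun y _ => hd y) hc.
rewrite in_itv/= => /andP[vc cu]; rewrite normrM ler_wpM2r// hC//.
move: uB vB; rewrite !ler_norml => /andP[? ?] /andP[? ?]; lra.
Qed.

(** The local bound on [ddh] makes [dh] Lipschitz on the range of [f]. On a short segment the mean
    value theorem turns the increment of h o f into [dh c] times that of [f], with [c] close to
    every value of [f] there. Hence h o f minus the candidate integral has increments at most e
    times the integral of |df|, and [constant_of_small_increments] applies. *)
Lemma ac_comp L f df (h dh ddh : R -> R) : 0 <= L -> ac L f df ->
  (forall y : R, is_derive y 1 h (dh y)) -> (forall y : R, is_derive y 1 dh (ddh y)) ->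
  (forall B : R, exists C : R, forall y : R, `|y| <= B -> `|ddh y| <= C) ->
  ac L (h \o f) (fun x => df x * dh (f x)).
Proof.
move=> L0 fac hd dhd ddhb.
have [B B0 fB] := ac_bounded fac.
have [C0 HC0] := ddhb B.
pose C : R := `|C0| + 1.
have C_gt0 : 0 < C by rewrite ltr_wpDl.
have HC y : `|y| <= B -> `|ddh y| <= C.
  move=> /HC0 /le_trans; apply; rewrite (le_trans (ler_norm _))// lerDl//.
have dhlip u v : `|u| <= B -> `|v| <= B -> `|dh u - dh v| <= C * `|u - v|.
  exact: increment_le.
have dh_bnd u : `|u| <= B -> `|dh u| <= `|dh 0| + C * B.
  move=> uB; rewrite -(subrK (dh 0) (dh u)) addrC.
  apply: le_trans (ler_normD _ _) _; rewrite lerD2l.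
  apply: le_trans (dhlip _ _ uB _) _; first by rewrite normr0.
  by rewrite subr0 ler_pM2l.
have mdh : measurable_fun [set: R] dh.
  apply: continuous_measurable_fun => y.
  by apply/differentiable_continuous/derivable1_diffP; case: (dhd y).
have mf := ac_measurable L0 fac.
have iI : mu.-integrable `[0, L] (EFin \o (fun x => df x * dh (f x))).
  apply: (integrable_mul_bounded _ (B := `|dh 0| + C * B)) => //.
  - by case: fac.
  - exact: measurableT_comp.
  - by move=> x; rewrite /= in_itv/= => x0L; exact/dh_bnd/fB.
split=> // x x0L.
pose F x := h (f x) - \int[mu]_(t in `[0, x]) (df t * dh (f t)).
suff : F x = F 0.
  rewrite /F set_itv1 Rintegral_set1 subr0 /= => <-.
  by rewrite subrK.
have inn := integrable_norm fac.1.
apply: (constant_of_small_increments (k := Num.norm \o df)) x0L => // e e0.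
have [d d0 Hd] := ac_modulus fac (divr_gt0 e0 C_gt0).
exists d => // s t s0 st tL std.
have tB : `|f t| <= B by apply: fB; rewrite tL (le_trans s0).
have sB : `|f s| <= B by apply: fB; rewrite s0 (le_trans st).
have ist k : mu.-integrable `[0, L] (EFin \o k) -> mu.-integrable `[s, t] (EFin \o k).
  exact: integrable_subitv.
have [c cB [ct Ec]] : exists2 c, `|c| <= B &
   (forall z, s <= z <= t -> `|f z - c| <= e / C) /\ h (f t) - h (f s) = dh c * (f t - f s).
  have mvt (u v : R) : u <= v -> exists2 c, u <= c <= v & h v - h u = dh c * (v - u).
    move=> uv.
    have hc : {within `[u, v], continuous h}.
      by apply: derivable_within_continuous => y _; case: (hd y).
    by have [c + E] := MVT_segment uv (fun y _ => hd y) hc; exists c.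
  (* The point [c] lies between [f s] and [f t]; since [f z] is within e / C of both, it is within e
     / C of [c]. *)
  have near z : s <= z <= t -> `|f z - f s| <= e / C /\ `|f t - f z| <= e / C.
    move=> /andP[sz zt]; split; apply: Hd => //.
    - exact: le_trans tL.
    - by apply: le_lt_trans std; rewrite lerD2r.
    - exact: le_trans sz.
    - by apply: le_lt_trans std; rewrite lerD2l lerN2.
  move: tB sB; rewrite !ler_norml => /andP[tB1 tB2] /andP[sB1 sB2].
  have [/mvt[c /andP[c1 c2] E]|/ltW/mvt[c /andP[c1 c2] E]] := leP (f s) (f t);
    exists c; (try by rewrite ler_norml; lra); split=> [z /near|].
  - rewrite !ler_norml => -[] /andP[? ?] /andP[? ?]; lra.
  - by [].
  - rewrite !ler_norml => -[] /andP[? ?] /andP[? ?]; lra.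
  - by rewrite -opprB E; ring.
have -> : F t - F s = \int[mu]_(z in `[s, t]) (dh c * df z - df z * dh (f z)).
  rewrite /F (@Rintegral_cat _ 0 s t)//; last exact: integrable_subitv iI.
  have -> : \int[mu]_(z in `[s, t]) (dh c * df z - df z * dh (f z)) =
     dh c * \int[mu]_(z in `[s, t]) df z - \int[mu]_(z in `[s, t]) (df z * dh (f z)).
    have idf := ist _ fac.1.
    by rewrite RintegralB ?RintegralZl//; [exact: integrable_scale|exact: ist].
  rewrite -(ac_increment fac)// -Ec; ring.
apply: le_Rintegral_normM.
- apply: (ist (fun z => dh c * df z - df z * dh (f z))).
  apply: integrable_sub => //.
  by apply: integrable_scale => //; case: fac.
- exact: ist.
- move=> z zst /=; rewrite mulrC -mulrBr normrM mulrC ler_wpM2r//.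
  have zB : `|f z| <= B.
    by move: zst => /andP[sz zt]; apply: fB; rewrite (le_trans s0 sz) (le_trans zt tL).
  apply: le_trans (dhlip _ _ cB zB) _.
  by rewrite mulrC -ler_pdivlMr// distrC ct.
Qed.

Lemma ac_sqr L f df : 0 <= L -> ac L f df -> ac L (fun x => f x ^+ 2) (fun x => 2 * (f x * df x)).
Proof.
move=> L0 fac.
have := @ac_comp L f df (fun y => y ^+ 2) (fun y => 2 * y) (fun=> 2) L0 fac.
have d1 (y : R) : is_derive y 1 (fun y : R => y ^+ 2) (2 * y).
  by apply: is_derive_eq; rewrite /GRing.scale/=; ring.
have d2 (y : R) : is_derive y 1 (fun y : R => 2 * y) 2.
  by apply: is_derive_eq; rewrite /GRing.scale/=; ring.
move=> /(_ d1 d2) H.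
apply: ac_ext (H _) _ _ => //=; last by move=> x _; ring.
by move=> B; exists `|2|.
Qed.

(** Polarization: 4 f g = (f + g)^2 - (f - g)^2 reduces products to squares. *)
Lemma ac_mul L f g df dg : 0 <= L -> ac L f df -> ac L g dg ->
  ac L (fun x => f x * g x) (fun x => df x * g x + f x * dg x).
Proof.
move=> L0 fac gac.
have S1 := ac_sqr L0 (ac_lin 1 1 fac gac).
have S2 := ac_sqr L0 (ac_lin 1 (-1) fac gac).
apply: ac_ext (ac_lin (1 / 4) (- (1 / 4)) S1 S2) _ _ => x _ /=; by field.
Qed.

End AbsolutelyContinuous.

(** * The pointwise bound *)

Section Energy.
Context {R : realType}.
Notation mu := (@lebesgue_measure R).
Implicit Types (f g df dg : R -> R) (L l s t x : R).

Lemma ac_expR L l : 0 <= L -> ac L (fun x => expR (l * x)) (fun x => l * expR (l * x)).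
Proof.
move=> L0.
have lac := ac_lin l 0 (ac_id L) (ac_id L).
apply: ac_ext (ac_comp L0 lac (@is_derive_expR R) (@is_derive_expR R) _) _ _.
- move=> B; exists (expR B) => y; rewrite ler_norml => /andP[_ yB].
  by rewrite ger0_norm ?expR_ge0// ler_expR.
- by move=> x _ /=; rewrite mul0r addr0.
- by move=> x _ /=; rewrite mul0r mulr1 !addr0 mul0r addr0.
Qed.

(* The minimizer with the given end values is w = P e^(l x) + Q e^(-l x), and
   f'^2 + l^2 f^2 dominates the derivative of 2 f w' - w w'. *)
Lemma energy_segment L l f df s t : 0 < l -> 0 <= s -> s < t -> t <= L ->
  ac L f df -> mu.-integrable `[0, L] (EFin \o (fun x => df x ^+ 2)) ->
  l * ((f s ^+ 2 + f t ^+ 2) * (expR (l * t) ^+ 2 + expR (l * s) ^+ 2)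
       - 4 * expR (l * s) * expR (l * t) * (f s * f t))
    / (expR (l * t) ^+ 2 - expR (l * s) ^+ 2)
  <= \int[mu]_(x in `[s, t]) (df x ^+ 2 + l ^+ 2 * f x ^+ 2).
Proof.
move=> l0 s0 st tL fac idf2; set p := expR (l * s); set q := expR (l * t).
have L0 : 0 <= L by apply: le_trans tL; exact/ltW/(le_lt_trans s0).
have p0 : 0 < p by exact: expR_gt0.
have pq : p < q by rewrite ltr_expR ltr_pM2l.
have q0 : 0 < q by exact: expR_gt0.
have D0 : q ^+ 2 - p ^+ 2 != 0 by rewrite subr_eq0 gt_eqF// ltr_pXn2r// ?nnegrE ltW.
(* [P] and [Q] solve the linear system P p + Q / p = f(s), P q + Q / q = f(t), that is, w(s) = f(s)
   and w(t) = f(t). *)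
pose P := (q * f t - p * f s) / (q ^+ 2 - p ^+ 2).
pose Q := p * q * (q * f s - p * f t) / (q ^+ 2 - p ^+ 2).
pose w x := P * expR (l * x) + Q * expR (- l * x).
pose dw x := P * (l * expR (l * x)) + Q * (- l * expR (- l * x)).
have wac : ac L w dw by exact: ac_lin (ac_expR l L0) (ac_expR (- l) L0).
(* The Euler-Lagrange equation w'' = l^2 w. Because of it, the derivative of 2 f w' - w w' falls
   short of f'^2 + l^2 f^2 by exactly (f' - w')^2 + l^2 (f - w)^2. *)
have dwac : ac L dw (fun x => l ^+ 2 * w x).
  apply: ac_ext (ac_lin (P * l) (Q * - l) (ac_expR l L0) (ac_expR (- l) L0)) _ _.
  - by move=> x _; rewrite /dw; ring.
  - by move=> x _; rewrite /w; ring.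
have Phiac := ac_lin 2 (-1) (ac_mul L0 fac dwac) (ac_mul L0 wac dwac).
have ws : w s = f s.
  by rewrite /w mulNr expRN -/p /P /Q; field; rewrite D0 gt_eqF.
have wt : w t = f t.
  by rewrite /w mulNr expRN -/q /P /Q; field; rewrite D0 gt_eqF.
(* The left side is the increment of 2 f w' - w w' over [s, t]. *)
have -> : l * ((f s ^+ 2 + f t ^+ 2) * (q ^+ 2 + p ^+ 2) - 4 * p * q * (f s * f t))
    / (q ^+ 2 - p ^+ 2) =
    2 * (f t * dw t) + -1 * (w t * dw t) - (2 * (f s * dw s) + -1 * (w s * dw s)).
  rewrite ws wt /dw !mulNr !expRN -/p -/q /P /Q; field.
  by rewrite D0 !gt_eqF.
rewrite (ac_increment Phiac s0 (ltW st) tL).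
apply: le_Rintegral => //.
- exact: (integrable_subitv s0 tL Phiac.1).
- apply: (integrable_subitv s0 tL); apply: integrable_add => //.
  apply: integrable_scale => //; exact: integrable_ac (ac_sqr L0 fac).
- move=> x _; rewrite -subr_ge0.
  rewrite [leRHS](_ : _ = (df x - dw x) ^+ 2 + l ^+ 2 * (f x - w x) ^+ 2); last by ring.
  exact: addr_ge0 (sqr_ge0 _) (mulr_ge0 (sqr_ge0 _) (sqr_ge0 _)).
Qed.

(* The difference of the two sides is a positive multiple of
   |y - ((q^2 - m^2) x + q (m^2 - 1) z) / (m (q^2 - 1))|^2, where z is x rotated
   back by the flux angle, X = |x|^2 = |z|^2 and <x, z> = c X. *)
Lemma two_segments_bound (m q c X Y xy zy : R) : 1 < m -> m < q ->
  0 <= Y - 2 * ((q ^+ 2 - m ^+ 2) * xy + q * (m ^+ 2 - 1) * zy) / (m * (q ^+ 2 - 1))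
    + ((q ^+ 2 - m ^+ 2) ^+ 2 * X + (q * (m ^+ 2 - 1)) ^+ 2 * X
       + 2 * (q ^+ 2 - m ^+ 2) * (q * (m ^+ 2 - 1)) * (c * X)) / (m * (q ^+ 2 - 1)) ^+ 2 ->
  2 * X * (q ^+ 2 + 1 - 2 * c * q) / (q ^+ 2 - 1) <=
  ((Y + X) * (m ^+ 2 + 1) - 4 * m * xy) / (m ^+ 2 - 1)
  + ((X + Y) * (q ^+ 2 + m ^+ 2) - 4 * m * q * zy) / (q ^+ 2 - m ^+ 2).
Proof.
move=> m1 mq; set S := (X in 0 <= X) => S0; rewrite -subr_ge0.
have m0 : 0 < m by lra.
have D1 : 0 < m ^+ 2 - 1 by nra.
have D2 : 0 < q ^+ 2 - m ^+ 2 by nra.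
have D3 : 0 < q ^+ 2 - 1 by nra.
rewrite [leRHS](_ : _ = 2 * m ^+ 2 * (q ^+ 2 - 1) / ((m ^+ 2 - 1) * (q ^+ 2 - m ^+ 2)) * S).
  by rewrite mulr_ge0// divr_ge0// ?mulr_ge0// ?sqr_ge0// ltW.
by rewrite /S; field; rewrite !gt_eqF.
Qed.

Lemma integrable_sqr_left L f g df dg : ac L f df -> ac L g dg ->
  mu.-integrable `[0, L] (EFin \o (fun x => df x ^+ 2 + dg x ^+ 2)) ->
  mu.-integrable `[0, L] (EFin \o (fun x => df x ^+ 2)).
Proof.
move=> fac gac; apply: le_integrable => //.
  apply/measurable_EFinP; apply: measurable_funX.
  by apply/measurable_EFinP; case: fac => /integrableP[].
move=> x _; rewrite lee_fin /= !ger0_norm ?addr_ge0 ?sqr_ge0// lerDl sqr_ge0//.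
Qed.

(** Here [f] and [g] are the real and imaginary parts of a function v with v(L) = (c + i s) v(0).
    For q = e^T and T = l L, the quotient (q^2 + 1 - 2 c q) / (q^2 - 1) equals (cosh T - c) / sinh
    T, so the condition on [K] bounds it below by 1 / K. For interior x the minimal energies on
    [0, x] and [x, L] are added, and v(0) is eliminated by [two_segments_bound]. *)
Lemma pointwise_bound L l (c s K : R) f g df dg : 0 < L -> 0 < l ->
  ac L f df -> ac L g dg ->
  mu.-integrable `[0, L] (EFin \o (fun x => df x ^+ 2 + dg x ^+ 2)) ->
  c ^+ 2 + s ^+ 2 = 1 ->
  f L = c * f 0 - s * g 0 -> g L = s * f 0 + c * g 0 ->
  0 <= K -> (forall q, 1 <= q -> q ^+ 2 - 1 <= K * (q ^+ 2 + 1 - 2 * c * q)) ->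
  forall x, 0 <= x <= L ->
  2 * l * (f x ^+ 2 + g x ^+ 2) <=
  K * \int[mu]_(x in `[0, L]) (df x ^+ 2 + dg x ^+ 2 + l ^+ 2 * (f x ^+ 2 + g x ^+ 2)).
Proof.
move=> L0 l0 fac gac ie cs fL gL K0 HK x /andP[x0 xL].
have L0' : 0 <= L by exact: ltW.
pose q := expR (l * L).
have q1 : 1 < q by rewrite expR_gt1 mulr_gt0.
have D3 : 0 < q ^+ 2 - 1 by nra.
have idf := integrable_sqr_left fac gac ie.
have idg : mu.-integrable `[0, L] (EFin \o (fun x => dg x ^+ 2)).
  apply: (integrable_sqr_left gac fac); apply: eq_integrable ie => // y _ /=.
  by rewrite addrC.
have iG h dh : ac L h dh -> mu.-integrable `[0, L] (EFin \o (fun x => dh x ^+ 2)) ->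
    mu.-integrable `[0, L] (EFin \o (fun x => dh x ^+ 2 + l ^+ 2 * h x ^+ 2)).
  move=> hac ih; apply: integrable_add => //; apply: integrable_scale => //.
  exact: (integrable_ac L0' (ac_sqr L0' hac)).
have if_ := iG _ _ fac idf; have ig_ := iG _ _ gac idg.
have -> : \int[mu]_(x in `[0, L]) (df x ^+ 2 + dg x ^+ 2 + l ^+ 2 * (f x ^+ 2 + g x ^+ 2))
  = \int[mu]_(x in `[0, L]) (df x ^+ 2 + l ^+ 2 * f x ^+ 2)
    + \int[mu]_(x in `[0, L]) (dg x ^+ 2 + l ^+ 2 * g x ^+ 2).
  rewrite -RintegralD//; apply: eq_Rintegral => y _; ring.
have N0L : f L ^+ 2 + g L ^+ 2 = f 0 ^+ 2 + g 0 ^+ 2.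
  rewrite fL gL [LHS](_ : _ = (c ^+ 2 + s ^+ 2) * (f 0 ^+ 2 + g 0 ^+ 2)); last by ring.
  by rewrite cs mul1r.
suff main : l * (2 * (f x ^+ 2 + g x ^+ 2) * (q ^+ 2 + 1 - 2 * c * q) / (q ^+ 2 - 1))
  <= \int[mu]_(x in `[0, L]) (df x ^+ 2 + l ^+ 2 * f x ^+ 2)
    + \int[mu]_(x in `[0, L]) (dg x ^+ 2 + l ^+ 2 * g x ^+ 2).
  apply: le_trans (ler_wpM2l K0 main).
  have N0 : 0 <= 2 * l * (f x ^+ 2 + g x ^+ 2).
    by rewrite mulr_ge0 ?addr_ge0 ?sqr_ge0// mulr_ge0// ltW.
  have := ler_wpM2l N0 (HK q (ltW q1)).
  rewrite -ler_pdivlMr// => /le_trans; apply.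
  rewrite le_eqVlt; apply/orP; left; apply/eqP; field.
  by rewrite gt_eqF.
(* The single segment [0, L] settles x = 0, and also x = L because |v(L)| = |v(0)|. *)
have ends : l * (2 * (f 0 ^+ 2 + g 0 ^+ 2) * (q ^+ 2 + 1 - 2 * c * q) / (q ^+ 2 - 1))
  <= \int[mu]_(x in `[0, L]) (df x ^+ 2 + l ^+ 2 * f x ^+ 2)
    + \int[mu]_(x in `[0, L]) (dg x ^+ 2 + l ^+ 2 * g x ^+ 2).
  apply: le_trans (lerD (energy_segment l0 (lexx 0) L0 (lexx L) fac idf)
                        (energy_segment l0 (lexx 0) L0 (lexx L) gac idg)).
  rewrite mulr0 expR0 -/q expr1n -mulrDl -mulrDr.
  rewrite [X in _ <= l * X / _](_ : _ =
     (f 0 ^+ 2 + g 0 ^+ 2 + (f L ^+ 2 + g L ^+ 2)) * (q ^+ 2 + 1)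
     - 4 * q * (f 0 * f L + g 0 * g L)); last by ring.
  rewrite N0L fL gL le_eqVlt; apply/orP; left; apply/eqP; field.
  by rewrite gt_eqF.
move: x0; rewrite le_eqVlt => /predU1P[<-//|x0].
move: xL; rewrite le_eqVlt => /predU1P[->|xL]; first by rewrite N0L.
pose m := expR (l * x).
have m1 : 1 < m by rewrite expR_gt1 mulr_gt0.
have mq : m < q by rewrite ltr_expR ltr_pM2l.
have D1 : 0 < m ^+ 2 - 1 by nra.
have D2 : 0 < q ^+ 2 - m ^+ 2 by nra.
rewrite (Rintegral_cat (ltW x0) (ltW xL) if_) (Rintegral_cat (ltW x0) (ltW xL) ig_).
rewrite addrACA.
apply: le_trans (lerD
  (lerD (energy_segment l0 (lexx 0) x0 (ltW xL) fac idf)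
        (energy_segment l0 (lexx 0) x0 (ltW xL) gac idg))
  (lerD (energy_segment l0 (ltW x0) xL (lexx L) fac idf)
        (energy_segment l0 (ltW x0) xL (lexx L) gac idg))).
rewrite mulr0 expR0 -/q -/m expr1n.
(* The inner product of v(0) with v(x) rotated back by the phase c + i s; it equals the inner
   product of v(L) with v(x). *)
pose zy := (c * f x + s * g x) * f 0 + (c * g x - s * f x) * g 0.
have B := @two_segments_bound m q c (f x ^+ 2 + g x ^+ 2) (f 0 ^+ 2 + g 0 ^+ 2)
  (f 0 * f x + g 0 * g x) zy m1 mq.
(* With |v(L)| = |v(0)| built in here, the later expansion of [f L] and [g L] is an identity that
   [field] proves without c^2 + s^2 = 1. *)
have -> : f L ^+ 2 = f 0 ^+ 2 + g 0 ^+ 2 - g L ^+ 2 by rewrite -N0L addrK.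
apply: le_trans (ler_wpM2l (ltW l0) (B _)) _; last first.
  rewrite le_eqVlt; apply/orP; left; apply/eqP; rewrite fL gL /zy; field.
  by rewrite !gt_eqF.
set M := m * (q ^+ 2 - 1); set a1 := q ^+ 2 - m ^+ 2; set a2 := q * (m ^+ 2 - 1).
have M0 : M != 0 by rewrite gt_eqF// mulr_gt0//; lra.
have X2 : (c * f x + s * g x) ^+ 2 + (c * g x - s * f x) ^+ 2 = f x ^+ 2 + g x ^+ 2.
  rewrite [LHS](_ : _ = (c ^+ 2 + s ^+ 2) * (f x ^+ 2 + g x ^+ 2)); last by ring.
  by rewrite cs mul1r.
(* The remaining premise is the squared distance from v(0) to its optimal value, given v(x). *)
rewrite [X in _ <= X](_ : _ =
   (f 0 - (a1 * f x + a2 * (c * f x + s * g x)) / M) ^+ 2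
   + (g 0 - (a1 * g x + a2 * (c * g x - s * f x)) / M) ^+ 2).
  by rewrite addr_ge0 ?sqr_ge0.
(* One copy of |v(x)|^2 is traded for the squared norm of the rotated vector, which makes the
   expansion a plain polynomial identity. *)
by rewrite -[X in a2 ^+ 2 * X]X2 /zy; field.
Qed.

End Energy.

Section Magnetic.
Context {R : realType}.
Notation mu := (@lebesgue_measure R).
Implicit Types (a p q dp dq : R -> R) (L l x : R).

Lemma ac_cos L f df : 0 <= L -> ac L f df ->
  ac L (fun x : R => cos (f x)) (fun x => df x * - sin (f x)).
Proof.
move=> L0 fac; apply: (ac_comp L0 fac (@is_derive_cos R) (ddh := fun y => - cos y)).
by move=> B; exists 1 => y _; rewrite normrN cos_max.
Qed.

Lemma ac_sin L f df : 0 <= L -> ac L f df ->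
  ac L (fun x : R => sin (f x)) (fun x => df x * cos (f x)).
Proof.
move=> L0 fac; apply: (ac_comp L0 fac (@is_derive_sin R) (@is_derive_cos R)).
by move=> B; exists 1 => y _; rewrite normrN sin_max.
Qed.

(* With A' = a, the function v = e^(iA) u satisfies |v'| = |(i d/dx - a) u|. *)
Lemma gauge_bound L l (K : R) a p q dp dq : 0 < L -> 0 < l ->
  mu.-integrable `[0, L] (EFin \o a) ->
  ac L p dp -> ac L q dq -> p L = p 0 -> q L = q 0 ->
  mu.-integrable `[0, L]
    (EFin \o (fun x => (- dq x - a x * p x) ^+ 2 + (dp x - a x * q x) ^+ 2)) ->
  0 <= K ->
  (forall z, 1 <= z -> z ^+ 2 - 1 <=
     K * (z ^+ 2 + 1 - 2 * cos (\int[mu]_(x in `[0, L]) a x) * z)) ->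
  forall x, 0 <= x <= L ->
  2 * l * (p x ^+ 2 + q x ^+ 2) <=
  K * \int[mu]_(x in `[0, L])
        ((- dq x - a x * p x) ^+ 2 + (dp x - a x * q x) ^+ 2
         + l ^+ 2 * (p x ^+ 2 + q x ^+ 2)).
Proof.
move=> L0 l0 ia pac qac pL qL ie K0 HK x x0L.
have L0' : 0 <= L by exact: ltW.
pose A x := \int[mu]_(t in `[0, x]) a t.
have A0 : A 0 = 0 by rewrite /A set_itv1 Rintegral_set1.
have Aac : ac L A a by split => // y _; rewrite A0 add0r.
have Cac := ac_cos L0' Aac; have Sac := ac_sin L0' Aac.
(* These are the real and imaginary parts of e^(iA) (p + i q). *)
have v1ac := ac_lin 1 (-1) (ac_mul L0' pac Cac) (ac_mul L0' qac Sac).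
have v2ac := ac_lin 1 1 (ac_mul L0' pac Sac) (ac_mul L0' qac Cac).
have cs y := cos2Dsin2 (A y).
have unit (z w : R) y : (z * cos (A y) - w * sin (A y)) ^+ 2
    + (z * sin (A y) + w * cos (A y)) ^+ 2 = z ^+ 2 + w ^+ 2.
  rewrite [LHS](_ : _ = (cos (A y) ^+ 2 + sin (A y) ^+ 2) * (z ^+ 2 + w ^+ 2)).
    by rewrite cs mul1r.
  by ring.
have iE := pointwise_bound L0 l0 v1ac v2ac _ (cs L) _ _ K0 HK x0L.
have norm_v y : (1 * (p y * cos (A y)) + -1 * (q y * sin (A y))) ^+ 2
    + (1 * (p y * sin (A y)) + 1 * (q y * cos (A y))) ^+ 2 = p y ^+ 2 + q y ^+ 2.
  by rewrite -(unit (p y) (q y) y); ring.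
have norm_dv y :
    (1 * (dp y * cos (A y) + p y * (a y * - sin (A y)))
     + -1 * (dq y * sin (A y) + q y * (a y * cos (A y)))) ^+ 2
    + (1 * (dp y * sin (A y) + p y * (a y * cos (A y)))
       + 1 * (dq y * cos (A y) + q y * (a y * - sin (A y)))) ^+ 2
    = (- dq y - a y * p y) ^+ 2 + (dp y - a y * q y) ^+ 2.
  rewrite [RHS](_ : _ = (dp y - a y * q y) ^+ 2 + (dq y + a y * p y) ^+ 2).
    by rewrite -(unit (dp y - a y * q y) (dq y + a y * p y) y); ring.
  by ring.
rewrite norm_v in iE.
apply: le_trans (iE _ _ _) _.
- by apply: eq_integrable ie => // y _; rewrite /= norm_dv.
- by rewrite A0 cos0 sin0 pL qL /A; ring.
- by rewrite A0 cos0 sin0 pL qL /A; ring.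
- rewrite le_eqVlt; apply/orP; left; apply/eqP; congr (_ * _).
  by apply: eq_Rintegral => y _; rewrite norm_dv norm_v.
Qed.

(** * The constant K as a function of the flux *)

Lemma cos_period (m : int) (x : R) : cos (x + 2 * pi * m%:~R) = cos x.
Proof.
have nat (n : nat) (y : R) : cos (y + 2 * pi * n%:R) = cos y.
  have -> : 2 * pi * n%:R = (pi *+ 2) *+ n :> R.
    by rewrite mulr_natr mulr_natl.
  by rewrite (periodicn (@cosD2pi R)).
case: m => n; first by rewrite -pmulrn nat.
by rewrite NegzE mulrNz mulrN -pmulrn -(nat n.+1) subrK.
Qed.

Lemma sin_period (m : int) (x : R) : sin (x + 2 * pi * m%:~R) = sin x.
Proof.
by rewrite -cosBpihalf addrAC cos_period cosBpihalf.
Qed.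

Lemma frac1_bounds (al : R) : ~~ (al \is a Num.int) -> 0 < frac1 al < 1.
Proof.
move=> ali; have := floor_itv al; rewrite /frac1 => /andP[f1 f2].
apply/andP; split; last by move: f2; rewrite intrD; lra.
rewrite subr_gt0 lt_neqAle f1 andbT.
by apply: contraNneq ali => <-; exact: intr_int.
Qed.

(** Modulo 2 pi the angle lies in (0, pi/2) or (3 pi/2, 2 pi), away from the zeros of the sine. This
    makes the inverse in [Kconst] a genuine one. *)
Lemma sin_neq0_near_int (al : R) : ~~ (al \is a Num.int) ->
  ~~ (1 / 4 <= frac1 al <= 3 / 4) -> sin (2 * pi * al) != 0.
Proof.
move=> /frac1_bounds /andP[f0 f1] out.
have -> : 2 * pi * al = 2 * pi * frac1 al + 2 * pi * (Num.floor al)%:~R.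
  by rewrite -mulrDr subrK.
rewrite sin_period.
have p0 := pi_gt0 R.
have [small|big] := ltP (frac1 al) (1 / 4).
  by rewrite gt_eqF// sin_gt0_pi//; apply/andP; split; nra.
have {}big : 3 / 4 < frac1 al by rewrite ltNge; move: out; rewrite big.
(* Subtracting a full turn places the angle in (-pi/2, 0). *)
have -> : 2 * pi * frac1 al = - (2 * pi * (1 - frac1 al)) + 2 * pi * 1%:~R.
  by rewrite /=; ring.
rewrite sin_period sinN oppr_eq0 gt_eqF// sin_gt0_pi//.
by apply/andP; split; nra.
Qed.

Lemma Kconst_gt0 (al : R) : ~~ (al \is a Num.int) -> 0 < Kconst al.
Proof.
move=> ali; rewrite /Kconst; case: ifPn => // out.
by rewrite invr_gt0 normr_gt0 sin_neq0_near_int.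
Qed.

(** With z = e^T this reads sinh T <= K (cosh T - cos(2 pi alpha)). For alpha mod 1 in [1/4, 3/4]
    the cosine is at most 0 and K = 1 suffices. Otherwise it is Cauchy-Schwarz for the vectors (|s|,
    c) and (z^2 - 1, 2 z), of lengths 1 and z^2 + 1. *)
Lemma Kconst_bound (al z : R) : ~~ (al \is a Num.int) -> 1 <= z ->
  z ^+ 2 - 1 <= Kconst al * (z ^+ 2 + 1 - 2 * cos (2 * pi * al) * z).
Proof.
move=> ali z1; rewrite /Kconst; case: ifPn => [/andP[f1 f2]|out].
  suff : cos (2 * pi * al) <= 0 by rewrite mul1r; nra.
  have -> : 2 * pi * al = 2 * pi * frac1 al + 2 * pi * (Num.floor al)%:~R.
    by rewrite -mulrDr subrK.
  rewrite cos_period.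
  have p0 := pi_gt0 R.
  have -> : 2 * pi * frac1 al = (2 * pi * frac1 al - pi) + pi by ring.
  rewrite cosDpi oppr_le0 cos_ge0_pihalf//.
  by apply/andP; split; nra.
have s0 := sin_neq0_near_int ali out.
set s := sin _ in s0 *; set c := cos _.
have cs : c ^+ 2 + s ^+ 2 = 1 by exact: cos2Dsin2.
have S0 : 0 < `|s| by rewrite normr_gt0.
have S2 : `|s| ^+ 2 = s ^+ 2 by rewrite real_normK// num_real.
rewrite mulrC ler_pdivlMr// mulrC.
have z2 : 0 <= z ^+ 2 + 1 by rewrite addr_ge0 ?sqr_ge0.
suff : `| `|s| * (z ^+ 2 - 1) + 2 * c * z| <= `|z ^+ 2 + 1|.
  by rewrite [X in _ <= X]ger0_norm// => /(le_trans (ler_norm _)); lra.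
rewrite -ler_sqr ?nnegrE ?normr_ge0// !real_normK ?num_real//.
rewrite -subr_ge0.
(* Lagrange's identity; the second summand vanishes by c^2 + s^2 = 1. *)
rewrite [leRHS](_ : _ = (2 * z * `|s| - c * (z ^+ 2 - 1)) ^+ 2 + (1 - (c ^+ 2 + `|s| ^+ 2)) * (4 * z ^+ 2 + (z ^+ 2 - 1) ^+ 2)).
  by rewrite S2 cs subrr mul0r addr0 sqr_ge0.
by ring.
Qed.

End Magnetic.

(** * The trace inequality *)

Section TraceInequality.
Context {R : realType}.
Local Notation C := (complex R).
Local Notation Re := (@complex.Re R).
Local Notation Im := (@complex.Im R).
Local Notation "A ^*t" := (map_mx Num.conj A^T) (at level 30).

Lemma ReD (x y : C) : Re (x + y) = Re x + Re y. Proof. by case: x y => [? ?] []. Qed.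
Lemma ImD (x y : C) : Im (x + y) = Im x + Im y. Proof. by case: x y => [? ?] []. Qed.
Lemma ReM (x y : C) : Re (x * y) = Re x * Re y - Im x * Im y.
Proof. by case: x y => [? ?] []. Qed.
Lemma ImM (x y : C) : Im (x * y) = Re x * Im y + Im x * Re y.
Proof. by case: x y => [? ?] []. Qed.

Lemma Re_sum I (s : seq I) (P : pred I) (F : I -> C) :
  Re (\sum_(i <- s | P i) F i) = \sum_(i <- s | P i) Re (F i).
Proof. by apply: (big_morph Re ReD). Qed.

(* In an orthonormal eigenbasis of G, with eigenvalues d_i, apply the hypothesis
   to the i-th eigenvector with l = d_i / K and multiply by d_i. *)
Lemma trace_cube_bound N (G A : 'M[C]_N) (K : R) : 0 < K ->
  G \is hermsymmx ->
  (forall v : 'rV_N, 0 <= Re ((v *m G *m v ^*t) 0 0)) ->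
  (forall (v : 'rV_N) (l : R), 0 < l ->
     2 * l * Re ((v *m G *m v ^*t) 0 0)
     <= K * (Re ((v *m A *m v ^*t) 0 0) + l ^+ 2 * Re ((v *m v ^*t) 0 0))) ->
  Re (\tr (G *m G *m G)) <= K ^+ 2 * Re (\tr (G *m A)).
Proof.
move=> K0 herm psd bnd.
have dreal := hermitian_spectral_diag_real herm.
have /hermitian_normalmx/orthomx_spectralP := herm.
set P := spectralmx G in dreal *; set d := spectral_diag G => Gd.
have Pu : P \is unitarymx := spectral_unitarymx G.
have Punit := unitarymx_unit Pu.
have PV := invmx_unitary Pu.
have PP : P *m P ^*t = 1%:M by rewrite -PV mulmxV.
pose B := P *m A *m P ^*t.
have PGP : P *m G *m P ^*t = diag_mx d.
  by rewrite Gd -PV !mulmxA mulmxV// mul1mx mulmxK.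
(* The rows of [P] are unit eigenvectors of [G]; the quadratic form of [X] at them is read off the
   diagonal of [X] in the eigenbasis. *)
have quad (X : 'M[C]_N) i : (row i P *m X *m (row i P) ^*t) 0 0 = (P *m X *m P ^*t) i i.
  rewrite -row_mul [LHS]mxE [RHS]mxE; apply: eq_bigr => k _.
  by rewrite [in LHS]mxE; congr (_ * _); rewrite !mxE.
have dRe i : d 0 i = (Re (d 0 i))%:C%C.
  by have /mxOverP/(_ 0 i)/RRe_real := dreal.
have d0 i : 0 <= Re (d 0 i).
  by have := psd (row i P); rewrite quad PGP mxE eqxx mulr1n.
have key i : Re (d 0 i) ^+ 3 <= K ^+ 2 * (Re (d 0 i) * Re (B i i)).
  (* A zero eigenvalue is set apart, since l = d_i / K must be positive; both sides then vanish. *)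
  have := d0 i; rewrite le_eqVlt => /predU1P[<-|di].
    by rewrite expr0n mul0r mulr0.
  have := bnd (row i P) (Re (d 0 i) / K) (divr_gt0 di K0).
  have := quad 1%:M i; rewrite !mulmx1 PP => E1.
  rewrite !quad E1 -/B PGP; set b := Re (B i i).
  have -> : diag_mx d i i = d 0 i by rewrite mxE eqxx mulr1n.
  have -> : Re ((1%:M : 'M[C]_N) i i) = 1 by rewrite mxE eqxx.
  rewrite mulr1 => H.
  have := ler_wpM2l (ltW (mulr_gt0 K0 di)) H.
  rewrite [leLHS](_ : _ = 2 * Re (d 0 i) ^+ 3); last by field; rewrite gt_eqF.
  rewrite [leRHS](_ : _ = K ^+ 2 * (Re (d 0 i) * b) + Re (d 0 i) ^+ 3); last first.
    by field; rewrite gt_eqF.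
  by lra.
(* Cyclicity of the trace moves the computation to the eigenbasis. *)
have trG Y : \tr (G *m Y) = \sum_i d 0 i * (P *m Y *m P ^*t) i i.
  rewrite {1}Gd PV -!mulmxA mxtrace_mulC !mulmxA -!(mulmxA (diag_mx d)).
  by apply: eq_bigr => i _; rewrite mul_diag_mx mxE.
have PGGP : P *m (G *m G) *m P ^*t = diag_mx d *m diag_mx d.
  by rewrite -PGP -PV !mulmxA mulmxKV.
rewrite -mulmxA !trG PGGP !Re_sum mulr_sumr ler_sum// => i _.
have reM y : Re (d 0 i * y) = Re (d 0 i) * Re y by rewrite dRe ReM /= mul0r subr0.
have -> : (diag_mx d *m diag_mx d) i i = d 0 i * d 0 i.
  by rewrite mul_diag_mx !mxE eqxx mulr1n.
rewrite !reM -/B; apply: le_trans (key i).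
by rewrite le_eqVlt; apply/orP; left; apply/eqP; ring.
Qed.

End TraceInequality.

(** * Complex-valued functions on a period: integrals, L_2 and absolute continuity *)

Section ComplexIntegral.
Context {R : realType}.
Local Notation C := (complex R).
Local Notation Re := (@complex.Re R).
Local Notation Im := (@complex.Im R).
Notation mu := (@lebesgue_measure R).
Local Notation per := `[0 : R, 2 * pi]%classic.
Implicit Types (f g df dg : R -> C).

Lemma twopi_gt0 : 0 < 2 * pi :> R.
Proof. by rewrite mulr_gt0// pi_gt0. Qed.

Definition cint f : C :=
  Complex (\int[mu]_(x in per) Re (f x)) (\int[mu]_(x in per) Im (f x)).

Lemma c_integrable_scale (c : C) f : c_integrable f -> c_integrable (fun x => c * f x).
Proof.
rewrite /c_integrable /per_int => -[fr fi]; split.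
- apply: eq_integrable (integrable_sub _ (integrable_scale _ (Re c) fr)
    (integrable_scale _ (Im c) fi)) => // x _; by rewrite /= ReM.
- apply: eq_integrable (integrable_add _ (integrable_scale _ (Re c) fi)
    (integrable_scale _ (Im c) fr)) => // x _; by rewrite /= ImM.
Qed.

Lemma c_integrable_sum I (s : seq I) (F : I -> R -> C) :
  (forall i, c_integrable (F i)) -> c_integrable (fun x => \sum_(i <- s) F i x).
Proof.
rewrite /c_integrable /per_int => iF; elim: s => [|i s [sr si]].
  by split; apply: eq_integrable (integrable0 _ _) => // x _; rewrite big_nil.
have [fr fi] := iF i; split.
- apply: eq_integrable (integrable_add _ fr sr) => // x _.
  by rewrite /= big_cons ReD.
- apply: eq_integrable (integrable_add _ fi si) => // x _.
  by rewrite /= big_cons ImD.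
Qed.

Lemma Rintegral_sum I (s : seq I) (F : I -> R -> R) :
  (forall i, mu.-integrable per (EFin \o F i)) ->
  \int[mu]_(x in per) (\sum_(i <- s) F i x) = \sum_(i <- s) \int[mu]_(x in per) F i x.
Proof.
move=> iF; elim: s => [|i s IH].
  rewrite big_nil; under eq_Rintegral do rewrite big_nil.
  by rewrite Rintegral_cst// mul0r.
rewrite big_cons -IH -RintegralD//.
  by apply: eq_Rintegral => x _; rewrite big_cons.
elim: s {IH} => [|j s IH].
  by apply: eq_integrable (integrable0 _ _) => // x _; rewrite /= big_nil.
by apply: eq_integrable (integrable_add _ (iF j) IH) => // x _; rewrite /= big_cons.
Qed.

Lemma Re_cint_scale (c : C) f : c_integrable f ->
  Re (c * cint f) = \int[mu]_(x in per) Re (c * f x).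
Proof.
rewrite /c_integrable /per_int => -[fr fi]; rewrite ReM /= -!RintegralZl// -RintegralB//;
  [|exact: integrable_scale|exact: integrable_scale].
by apply: eq_Rintegral => x _; rewrite ReM.
Qed.

Lemma EFin_Rintegral (h : R -> R) : mu.-integrable per (EFin \o h) ->
  (\int[mu]_(x in per) h x)%:E = (\int[mu]_(x in per) (h x)%:E)%E.
Proof. by move=> ih; rewrite fineK//; exact: integrable_fin_num. Qed.

Definition mint N (F : R -> 'M[C]_N) : 'M[C]_N :=
  \matrix_(n, m) cint (fun x => F x n m).

(** Linearity of the integral, in a form that covers both the quadratic form of an integrated matrix
    and its trace against a fixed matrix. *)
Lemma Re_sum_mint N (F : R -> 'M[C]_N) (c : 'I_N -> 'I_N -> C) :
  (forall n m, c_integrable (fun x => F x n m)) ->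
  Re (\sum_n \sum_m c n m * mint F n m)
  = \int[mu]_(x in per) Re (\sum_n \sum_m c n m * F x n m).
Proof.
move=> iF.
have iRe n m : mu.-integrable per (EFin \o (fun x => Re (c n m * F x n m))).
  by case: (c_integrable_scale (c n m) (iF n m)).
under eq_Rintegral do rewrite Re_sum.
rewrite Re_sum Rintegral_sum; last first.
  move=> n; by case: (c_integrable_sum (index_enum _)
    (fun m => c_integrable_scale (c n m) (iF n m))).
apply: eq_bigr => n _; under eq_Rintegral do rewrite Re_sum.
rewrite Re_sum Rintegral_sum//; apply: eq_bigr => m _.
by rewrite mxE Re_cint_scale.
Qed.

Definition square_integrable f : Prop :=
  [/\ measurable_fun per (fun x => Re (f x)), measurable_fun per (fun x => Im (f x)) &
      mu.-integrable per (EFin \o (fun x => cabs2 (f x)))].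

Lemma cabs2_ge0 (z : C) : 0 <= cabs2 z.
Proof. by rewrite addr_ge0 ?sqr_ge0. Qed.

Lemma Re_mulconj (z : C) : Re (z * conjc z) = cabs2 z.
Proof. by case: z => x y; rewrite /cabs2 /=; ring. Qed.

(** Follows from (r +- t)^2 >= 0 and (s +- u)^2 >= 0. It dominates the real and imaginary parts of f
    conj(g) by |f|^2 + |g|^2. *)
Lemma norm_sum_prod_le (r s t u : R) : `|r * t + s * u| <= r ^+ 2 + s ^+ 2 + (t ^+ 2 + u ^+ 2).
Proof.
have := (sqr_ge0 (r + t), sqr_ge0 (r - t), sqr_ge0 (s + u), sqr_ge0 (s - u)).
by rewrite ler_norml => -[[[]]] *; apply/andP; split; nra.
Qed.

Lemma square_integrable_mulconj f g : square_integrable f -> square_integrable g ->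
  c_integrable (fun x => f x * conjc (g x)).
Proof.
move=> [mfr mfi ifg] [mgr mgi igg].
rewrite /c_integrable /per_int.
have is_ : mu.-integrable per (EFin \o (fun x => cabs2 (f x) + cabs2 (g x))).
  exact: integrable_add.
split; apply: le_integrable is_ => //.
- apply/measurable_EFinP.
  apply: (eq_measurable_fun (fun x => Re (f x) * Re (g x) + Im (f x) * Im (g x))).
    by move=> x _; case: (f x) (g x) => [? ?] [? ?] /=; ring.
  by apply: measurable_funD; exact: measurable_funM.
- move=> x _; rewrite lee_fin /= [leRHS]ger0_norm; last exact: addr_ge0 (cabs2_ge0 _) (cabs2_ge0 _).
  rewrite /cabs2; case: (f x) (g x) => [r s] [t u] /=.
  by rewrite mulrN opprK norm_sum_prod_le.
- apply/measurable_EFinP.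
  apply: (eq_measurable_fun (fun x => Im (f x) * Re (g x) - Re (f x) * Im (g x))).
    by move=> x _; case: (f x) (g x) => [? ?] [? ?] /=; ring.
  by apply: measurable_funB; exact: measurable_funM.
- move=> x _; rewrite lee_fin /= [leRHS]ger0_norm; last exact: addr_ge0 (cabs2_ge0 _) (cabs2_ge0 _).
  rewrite /cabs2; case: (f x) (g x) => [r s] [t u] /=.
  by rewrite [t ^+ 2 + _]addrC -(sqrrN u) norm_sum_prod_le.
Qed.

Lemma square_integrable_scale_add (c : C) f g :
  square_integrable f -> square_integrable g ->
  square_integrable (fun x => c * f x + g x).
Proof.
move=> [mfr mfi ifg] [mgr mgi igg].
have mr : measurable_fun per (fun x => Re (c * f x + g x)).
  apply: (eq_measurable_fun (fun x => (Re c * Re (f x) - Im c * Im (f x)) + Re (g x))).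
    by move=> x _; rewrite ReD ReM.
  apply: measurable_funD => //; apply: measurable_funB; exact: measurable_funM.
have mi : measurable_fun per (fun x => Im (c * f x + g x)).
  apply: (eq_measurable_fun (fun x => (Re c * Im (f x) + Im c * Re (f x)) + Im (g x))).
    by move=> x _; rewrite ImD ImM.
  apply: measurable_funD => //; apply: measurable_funD; exact: measurable_funM.
split=> //.
have is_ : mu.-integrable per
    (EFin \o (fun x => 2 * cabs2 c * cabs2 (f x) + 2 * cabs2 (g x))).
  by apply: integrable_add => //; exact: integrable_scale.
apply: le_integrable is_ => //.
  by apply/measurable_EFinP; apply: measurable_funD; exact: measurable_funX.
move=> x _; rewrite lee_fin /= !ger0_norm ?cabs2_ge0//; last first.
  by rewrite (addr_ge0 (mulr_ge0 (mulr_ge0 _ (cabs2_ge0 _)) (cabs2_ge0 _)) (mulr_ge0 _ (cabs2_ge0 _))).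
rewrite /cabs2; case: c (f x) (g x) {mr mi} => [k h] [r s] [t u] /=.
(* Parallelogram law: 2 |c f|^2 + 2 |g|^2 - |c f + g|^2 = |c f - g|^2. *)
rewrite -subr_ge0 [leRHS](_ : _ = (k * r - h * s - t) ^+ 2 + (k * s + h * r - u) ^+ 2).
  by rewrite addr_ge0 ?sqr_ge0.
by ring.
Qed.

Lemma square_integrable_lincomb N (v : 'I_N -> C) (F : 'I_N -> R -> C) :
  (forall n, square_integrable (F n)) ->
  square_integrable (fun x => \sum_n v n * F n x).
Proof.
move=> iF; elim: (index_enum _) => [|n s IH].
  have -> : (fun x => \sum_(n <- [::]) v n * F n x) = (fun=> 0) :> (R -> C).
    by apply/funext => x; rewrite big_nil.
  split; [exact: measurable_cst|exact: measurable_cst|].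
  apply: eq_integrable (integrable0 _ _) => // x _.
  by rewrite /cabs2 /= expr0n addr0.
have -> : (fun x => \sum_(m <- n :: s) v m * F m x)
  = (fun x => v n * F n x + \sum_(m <- s) v m * F m x).
  by apply/funext => x; rewrite big_cons.
exact: square_integrable_scale_add.
Qed.

(** Taken componentwise, so that the complex sum and product rules follow from the real ones. *)
Definition acc f df : Prop :=
  ac (2 * pi) (fun x => Re (f x)) (fun x => Re (df x)) /\
  ac (2 * pi) (fun x => Im (f x)) (fun x => Im (df x)).

Lemma AC_acc f df : AC_with_deriv f df -> acc f df.
Proof.
move=> [[ir ii] E]; split; split => // x x0L.
- by rewrite E// ReD.
- by rewrite E// ImD.
Qed.

Lemma acc_cst (c : C) : acc (fun=> c) (fun=> 0).
Proof. by split; exact: ac_cst. Qed.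

Lemma acc_add f g df dg : acc f df -> acc g dg ->
  acc (fun x => f x + g x) (fun x => df x + dg x).
Proof.
move=> [fr fi] [gr gi]; split.
- by apply: ac_ext (ac_lin 1 1 fr gr) _ _ => x _; rewrite !mul1r ReD.
- by apply: ac_ext (ac_lin 1 1 fi gi) _ _ => x _; rewrite !mul1r ImD.
Qed.

Lemma acc_mul f g df dg : acc f df -> acc g dg ->
  acc (fun x => f x * g x) (fun x => df x * g x + f x * dg x).
Proof.
have L0 := ltW twopi_gt0.
move=> [fr fi] [gr gi]; split.
- apply: ac_ext (ac_lin 1 (-1) (ac_mul L0 fr gr) (ac_mul L0 fi gi)) _ _ => x _.
    by rewrite ReM; ring.
  by rewrite ReD !ReM; ring.
- apply: ac_ext (ac_lin 1 1 (ac_mul L0 fr gi) (ac_mul L0 fi gr)) _ _ => x _.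
    by rewrite ImM; ring.
  by rewrite ImD !ImM; ring.
Qed.

Lemma acc_conj f df : acc f df -> acc (fun x => conjc (f x)) (fun x => conjc (df x)).
Proof.
move=> [fr fi]; split.
- by apply: ac_ext fr _ _ => x _; [case: (f x)|case: (df x)].
- apply: ac_ext (ac_lin (-1) 0 fi fi) _ _ => x _; [case: (f x)|case: (df x)] => r s /=.
    by ring.
  by ring.
Qed.

Lemma acc_sum I (s : seq I) (F dF : I -> R -> C) : (forall i, acc (F i) (dF i)) ->
  acc (fun x => \sum_(i <- s) F i x) (fun x => \sum_(i <- s) dF i x).
Proof.
move=> H; elim: s => [|i s IH].
  have z (G : I -> R -> C) : (fun x => \sum_(i <- [::]) G i x) = (fun=> 0).
    by apply/funext => x; rewrite big_nil.
  by rewrite !z; exact: acc_cst.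
have z (G : I -> R -> C) : (fun x => \sum_(j <- i :: s) G j x)
    = (fun x => G i x + \sum_(j <- s) G j x).
  by apply/funext => x; rewrite big_cons.
by rewrite !z; exact: acc_add.
Qed.

Lemma acc_c_integrable f df : acc f df -> c_integrable f.
Proof.
move=> [fr fi]; have L0 := ltW twopi_gt0.
by split; [exact: (integrable_ac L0 fr)|exact: (integrable_ac L0 fi)].
Qed.

Lemma acc_square_integrable f df : acc f df -> square_integrable f.
Proof.
move=> [fr fi]; have L0 := ltW twopi_gt0; split.
- exact: (ac_measurable L0 fr).
- exact: (ac_measurable L0 fi).
- apply: integrable_add => //.
  + exact: (integrable_ac L0 (ac_sqr L0 fr)).
  + exact: (integrable_ac L0 (ac_sqr L0 fi)).
Qed.

End ComplexIntegral.

(** * Gram matrices of the orthonormal system and the integrated inequality *)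

Section MagneticTrace.
Context {R : realType}.
Local Notation C := (complex R).
Local Notation Re := (@complex.Re R).
Local Notation Im := (@complex.Im R).
Notation mu := (@lebesgue_measure R).
Local Notation per := `[0 : R, 2 * pi]%classic.
Local Notation "A ^*t" := (map_mx Num.conj A^T) (at level 30).

(** Serves to add up the scalar bounds of the M components of a vector-function. *)
Lemma le_quadratic_sum M (K l x y z : R) (X Y Z : 'I_M -> R) :
  x = \sum_j X j -> y = \sum_j Y j -> z = \sum_j Z j ->
  (forall j, 2 * l * X j <= K * (Y j + l ^+ 2 * Z j)) ->
  2 * l * x <= K * (y + l ^+ 2 * z).
Proof.
move=> -> -> -> H; rewrite 2!mulr_sumr -big_split /= mulr_sumr.
exact: ler_sum.
Qed.

Lemma quadratic_form_sum N (X : 'M[C]_N) (v : 'rV[C]_N) :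
  (v *m X *m v ^*t) 0 0 = \sum_n \sum_m (v 0 n * conjc (v 0 m)) * X n m.
Proof.
rewrite mxE exchange_big /=; apply: eq_bigr => m _.
rewrite !mxE mulr_suml; apply: eq_bigr => n _.
by rewrite mulrAC.
Qed.

Lemma quadratic_form_gram N M (F : 'M[C]_(N, M)) (v : 'rV[C]_N) :
  Re ((v *m (F *m F ^*t) *m v ^*t) 0 0) = \sum_j cabs2 ((v *m F) 0 j).
Proof.
have -> : v *m (F *m F ^*t) *m v ^*t = (v *m F) *m (v *m F) ^*t.
  by rewrite trmx_mul map_mxM !mulmxA.
rewrite mxE Re_sum; apply: eq_bigr => j _.
by rewrite !mxE -Re_mulconj.
Qed.

Lemma gram_hermitian N M (F : 'M[C]_(N, M)) : F *m F ^*t \is hermsymmx.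
Proof.
apply/is_hermitianmxP; rewrite expr0 scale1r trmx_mul map_mxM.
congr (_ *m _); apply/matrixP => i j; rewrite !mxE.
exact: (esym (conjCK _)).
Qed.

Definition family_mx N M (F : 'I_N -> 'I_M -> R -> C) (x : R) : 'M[C]_(N, M) :=
  \matrix_(n, j) F n j x.

Definition gram N M (F : 'I_N -> 'I_M -> R -> C) (x : R) : 'M[C]_N :=
  family_mx F x *m (family_mx F x) ^*t.

Lemma gramE N M (F : 'I_N -> 'I_M -> R -> C) x n m :
  gram F x n m = \sum_j F n j x * conjc (F m j x).
Proof. by rewrite mxE; apply: eq_bigr => j _; rewrite !mxE. Qed.

Lemma gram_integrable N M (F : 'I_N -> 'I_M -> R -> C) n m :
  (forall n j, square_integrable (F n j)) ->
  c_integrable (fun x => gram F x n m).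
Proof.
move=> iF.
have -> : (fun x => gram F x n m) = (fun x => \sum_j F n j x * conjc (F m j x)).
  by apply/funext => x; exact: gramE.
by apply: c_integrable_sum => j; exact: square_integrable_mulconj.
Qed.

(** At each x the form of F F^* at v is the squared length of v F. Applied to the system it yields
    the L_2 norm of sum_n v_n phi_n, applied to its magnetic derivatives the energy. *)
Lemma Re_quadratic_mint N M (F : 'I_N -> 'I_M -> R -> C) (v : 'rV[C]_N) :
  (forall n j, square_integrable (F n j)) ->
  Re ((v *m mint (gram F) *m v ^*t) 0 0)
  = \sum_j \int[mu]_(x in per) cabs2 (\sum_n v 0 n * F n j x).
Proof.
move=> iF; rewrite quadratic_form_sum Re_sum_mint; last first.
  by move=> n m; exact: gram_integrable.
rewrite -Rintegral_sum; last first.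
  by move=> j; case: (square_integrable_lincomb (v 0) (iF ^~ j)).
apply: eq_Rintegral => x _; rewrite -quadratic_form_sum quadratic_form_gram.
apply: eq_bigr => j _; rewrite mxE; congr cabs2.
by apply: eq_bigr => n _; rewrite mxE.
Qed.

(** If F has the rows phi_n(x), then U is the transpose of F^* F while the Gram matrix is F F^*;
    cyclicity of the trace identifies the traces of their cubes. *)
Lemma trace_Umat_cube N M (phi : 'I_N -> 'I_M -> R -> C) x :
  \tr (Umat phi x *m Umat phi x *m Umat phi x)
  = \tr (gram phi x *m gram phi x *m gram phi x).
Proof.
have -> : Umat phi x = ((family_mx phi x) ^*t *m family_mx phi x)^T.
  by apply/matrixP => j k; rewrite !mxE; apply: eq_bigr => n _; rewrite !mxE mulrC.
by rewrite -!trmx_mul mxtrace_tr /gram -!mulmxA mxtrace_mulC !mulmxA.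
Qed.

Lemma Re_magnetic (b : R) (z w : C) :
  Re (Complex 0 1 * z - Complex b 0 * w) = - Im z - b * Re w.
Proof. by case: z w => [? ?] [? ?] /=; ring. Qed.

Lemma Im_magnetic (b : R) (z w : C) :
  Im (Complex 0 1 * z - Complex b 0 * w) = Re z - b * Im w.
Proof. by case: z w => [? ?] [? ?] /=; ring. Qed.

Definition magnetic_der N M (a : R -> R) (phi dphi : 'I_N -> 'I_M -> R -> C) n j x : C :=
  Complex 0 1 * dphi n j x - Complex (a x) 0 * phi n j x.

Context (a : R -> R) (N M : nat) (phi dphi : 'I_N -> 'I_M -> R -> C).
Local Notation e := (magnetic_der a phi dphi).
Local Notation G := (gram phi).
Local Notation A := (mint (gram e)).

Context (ia : mu.-integrable per (EFin \o a)).
Context (al_int : ~~ (flux a \is a Num.int)).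
Context (phi_per : forall n j, periodic2pi (phi n j)).
Context (phi_ac : forall n j, acc (phi n j) (dphi n j)).
Context (phi_orth : mint G = 1%:M).
(** Placed before the assumption [e_fin], which it helps to verify in the final proof. *)
Lemma magnetic_der_measurable n j :
  measurable_fun per (fun x => Re (e n j x)) /\ measurable_fun per (fun x => Im (e n j x)).
Proof.
have [[ir Er] [ii Ei]] := phi_ac n j.
have [mr mi _] := acc_square_integrable (phi_ac n j).
have ma : measurable_fun per a by apply/measurable_EFinP; case/integrableP: ia.
have mdr : measurable_fun per (fun x => Re (dphi n j x)).
  by apply/measurable_EFinP; case/integrableP: ir.
have mdi : measurable_fun per (fun x => Im (dphi n j x)).
  by apply/measurable_EFinP; case/integrableP: ii.
split.
- apply: (eq_measurable_fun (fun x => - Im (dphi n j x) - a x * Re (phi n j x))).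
    by move=> x _; rewrite Re_magnetic.
  apply: measurable_funB; [exact: measurable_funN|exact: measurable_funM].
- apply: (eq_measurable_fun (fun x => Re (dphi n j x) - a x * Im (phi n j x))).
    by move=> x _; rewrite Im_magnetic.
  by apply: measurable_funB => //; exact: measurable_funM.
Qed.

Context (e_fin : forall n j,
  mu.-integrable per (EFin \o (fun x => cabs2 (e n j x)))).

Lemma e_square_integrable n j : square_integrable (e n j).
Proof. by have [? ?] := magnetic_der_measurable n j; split. Qed.

(** For each component j the scalar function u = sum_n v_n phi_n(., j) is periodic and absolutely
    continuous, so [gauge_bound] applies to it; the bounds are then summed over j. *)
Lemma gram_bound (v : 'rV[C]_N) (l : R) x : 0 < l -> 0 <= x <= 2 * pi ->
  2 * l * Re ((v *m G x *m v ^*t) 0 0)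
  <= Kconst (flux a) * (Re ((v *m A *m v ^*t) 0 0) + l ^+ 2 * Re ((v *m v ^*t) 0 0)).
Proof.
move=> l0 x0L.
have phi_sq n j := acc_square_integrable (phi_ac n j).
(* Orthonormality turns |v|^2 into the L_2 norm of sum_n v_n phi_n, matching the l^2 |u|^2 term of
   the energy. *)
have -> : v *m v ^*t = v *m mint G *m v ^*t by rewrite phi_orth mulmx1.
have qx : Re ((v *m G x *m v ^*t) 0 0) = _ := quadratic_form_gram _ v.
have qA := Re_quadratic_mint v e_square_integrable.
have qG := Re_quadratic_mint v phi_sq.
apply: (le_quadratic_sum qx qA qG) => j.
pose u x := \sum_n v 0 n * phi n j x.
pose du x := \sum_n v 0 n * dphi n j x.
pose w x := \sum_n v 0 n * e n j x.
have -> : (v *m family_mx phi x) 0 j = u x by rewrite mxE; apply: eq_bigr => n _; rewrite mxE.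
have [ur ui] : acc u du.
  apply: acc_sum => n; have := acc_mul (acc_cst (v 0 n)) (phi_ac n j).
  have -> : (fun x => 0 * phi n j x + v 0 n * dphi n j x) = (fun x => v 0 n * dphi n j x).
    by apply/funext => y; rewrite mul0r add0r.
  by [].
have uper : u (2 * pi) = u 0.
  by apply: eq_bigr => n _; rewrite -[2 * pi]add0r (phi_per n j).
have wE y : w y = Complex 0 1 * du y - Complex (a y) 0 * u y.
  by rewrite /w /du /u !mulr_sumr -sumrB; apply: eq_bigr => n _; rewrite /magnetic_der; ring.
have cw y : cabs2 (w y) = (- Im (du y) - a y * Re (u y)) ^+ 2
                          + (Re (du y) - a y * Im (u y)) ^+ 2.
  by rewrite wE /cabs2 Re_magnetic Im_magnetic.
have [_ _ iw] := square_integrable_lincomb (v 0) (fun n => e_square_integrable n j).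
have [_ _ iu] := square_integrable_lincomb (v 0) (fun n => phi_sq n j).
have := @gauge_bound R (2 * pi) l (Kconst (flux a)) a _ _ _ _ twopi_gt0 l0 ia ur ui.
rewrite uper => /(_ erefl erefl) H.
apply: le_trans (H _ _ _ x x0L) _.
- by apply: eq_integrable iw => // y _; rewrite /= -/(w y) cw.
- exact/ltW/Kconst_gt0.
(* The total phase, the integral of a over a period, is 2 pi times the flux. *)
- move=> z z1; have := Kconst_bound al_int z1.
  by rewrite /flux mulrA mulfV ?gt_eqF ?twopi_gt0// mul1r.
- rewrite le_eqVlt; apply/orP; left; apply/eqP; congr (_ * _).
  rewrite -RintegralZl// -RintegralD//; last exact: integrable_scale.
  by apply: eq_Rintegral => y _; rewrite -/(w y) cw.
Qed.

(** Entries of the Gram matrix are absolutely continuous, hence so are the triple products into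
    which the trace expands. *)
Lemma trace_cube_c_integrable : c_integrable (fun x => \tr (G x *m G x *m G x)).
Proof.
have Gac n m : exists dg, acc (fun x => G x n m) dg.
  have -> : (fun x => G x n m) = (fun x => \sum_j phi n j x * conjc (phi m j x)).
    by apply/funext => x; exact: gramE.
  by eexists; apply: acc_sum => j; apply: acc_mul (phi_ac n j) (acc_conj (phi_ac m j)).
have -> : (fun x => \tr (G x *m G x *m G x))
    = (fun x => \sum_n \sum_k \sum_m (G x n m * G x m k) * G x k n).
  apply/funext => x; apply: eq_bigr => n _; rewrite mxE; apply: eq_bigr => k _.
  by rewrite mxE mulr_suml.
apply: c_integrable_sum => n; apply: c_integrable_sum => k; apply: c_integrable_sum => m.
have [d1 H1] := Gac n m; have [d2 H2] := Gac m k; have [d3 H3] := Gac k n.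
exact: acc_c_integrable (acc_mul (acc_mul H1 H2) H3).
Qed.

(** Since G integrates to the identity, the energy sum Tr A equals the integral of Re Tr(G(x) A),
    and it suffices to compare integrands: at each x this is [trace_cube_bound] fed with
    [gram_bound]. *)
Lemma trace_cube_integral :
  \int[mu]_(x in per) Re (\tr (Umat phi x *m Umat phi x *m Umat phi x))
  <= Kconst (flux a) ^+ 2
     * \sum_n \sum_j \int[mu]_(x in per) cabs2 (e n j x).
Proof.
have phi_sq n j := acc_square_integrable (phi_ac n j).
have iG n m : c_integrable (fun x => G x n m) by exact: gram_integrable.
have trE (X : 'M[C]_N) : \tr (X *m A) = \sum_n \sum_m A m n * X n m.
  by apply: eq_bigr => n _; rewrite mxE; apply: eq_bigr => m _; rewrite mulrC.
have iGA : mu.-integrable per (EFin \o (fun x => Re (\tr (G x *m A)))).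
  have -> : (fun x => Re (\tr (G x *m A))) = (fun x => Re (\sum_n \sum_m A m n * G x n m)).
    by apply/funext => x; rewrite trE.
  apply: (proj1 (c_integrable_sum _ (F := fun n x => \sum_m A m n * G x n m) _)) => n.
  by apply: c_integrable_sum => m; exact: c_integrable_scale.
have -> : \sum_n \sum_j \int[mu]_(x in per) cabs2 (e n j x) = Re (\tr (mint G *m A)).
  rewrite phi_orth mul1mx /mxtrace Re_sum; apply: eq_bigr => n _.
  rewrite mxE /= -Rintegral_sum//; apply: eq_Rintegral => x _.
  by rewrite gramE Re_sum; apply: eq_bigr => j _; rewrite Re_mulconj.
rewrite trE Re_sum_mint// -RintegralZl//; last first.
  by apply: eq_integrable iGA => // x _; rewrite /= trE.
apply: le_Rintegral => //.
- have := trace_cube_c_integrable; rewrite /c_integrable /per_int => -[iT _].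
  by apply: eq_integrable iT => // x _; rewrite /= trace_Umat_cube.
- by apply: integrable_scale => //; apply: eq_integrable iGA => // x _; rewrite /= trE.
move=> x; rewrite /= in_itv/= => x0L; rewrite trace_Umat_cube -trE.
apply: trace_cube_bound.
- exact: Kconst_gt0.
- exact: gram_hermitian.
- by move=> v; rewrite quadratic_form_gram sumr_ge0// => j _; exact: cabs2_ge0.
- by move=> v l l0; exact: gram_bound.
Qed.

End MagneticTrace.

(** * Passage to extended-real integrals *)

Unset Implicit Arguments.

Theorem theorem6p2 (R : realType) (a : R -> R) (N M : nat)
  (phi dphi : 'I_N -> 'I_M -> R -> complex R) :
  (@lebesgue_measure R).-integrable (@per_int R) (fun x => (a x)%:E) ->
  ~~ (flux a \is a Num.int) ->
  (forall n j, periodic2pi (phi n j)) ->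
  (forall n j, AC_with_deriv (phi n j) (dphi n j)) ->
  (forall n m : 'I_N,
      int_re (fun x => \sum_(j < M) phi n j x * conjc (phi m j x))
        = ((n == m)%:R)%:E
   /\ int_im (fun x => \sum_(j < M) phi n j x * conjc (phi m j x)) = 0%E) ->
  (\int[lebesgue_measure]_(x in @per_int R)
      (complex.Re (\tr (Umat phi x *m Umat phi x *m Umat phi x)))%:E
   <= ((Kconst (flux a)) ^+ 2)%:E *
      \sum_(n < N) \sum_(j < M)
        \int[lebesgue_measure]_(x in @per_int R)
          (cabs2 (Complex 0 1 * dphi n j x - Complex (a x) 0 * phi n j x))%:E)%E.
Proof.
move=> ia al_int phi_per phi_AC orth.
have phi_ac n j := AC_acc (phi_AC n j).
have K0 : 0 < Kconst (flux a) ^+ 2 by rewrite exprn_gt0// Kconst_gt0.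
set S := (X in (_ <= _ * X)%E).
pose I n j : \bar R := (\int[lebesgue_measure]_(x in `[0%R, (2 * pi)%R])
  (cabs2 (magnetic_der a phi dphi n j x))%:E)%E.
have SE : S = (\sum_n \sum_j I n j)%E by [].
have I0 n j : (0 <= I n j)%E.
  by apply: integral_ge0 => x _; rewrite lee_fin cabs2_ge0.
(* Infinite energy makes the right-hand side infinite, because K^2 > 0. *)
have [Soo|Soo] := eqVneq S +oo%E; first by rewrite Soo gt0_muley ?lte_fin// leey.
(* In a finite sum of nonnegative terms, each term is at most the total. *)
have Iy n j : (I n j < +oo)%E.
  rewrite ltey; apply: contra Soo => /eqP Ioo; rewrite -leye_eq -Ioo SE.
  rewrite (bigD1 n)//= (bigD1 j)//= -addeA leeDl// adde_ge0//.
    by apply: sume_ge0 => k _.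
  by apply: sume_ge0 => k _; apply: sume_ge0 => i _.
have e_fin n j : lebesgue_measure.-integrable `[0, 2 * pi]
    (EFin \o (fun x => cabs2 (magnetic_der a phi dphi n j x))).
  apply/integrableP; split.
    have [mr mi] := magnetic_der_measurable ia phi_ac n j.
    by apply/measurable_EFinP; apply: measurable_funD; exact: measurable_funX.
  apply: le_lt_trans (Iy n j); rewrite le_eqVlt; apply/orP; left; apply/eqP.
  by apply: eq_integral => x _; rewrite /= ger0_norm// cabs2_ge0.
have gram1 : mint (gram phi) = 1%:M.
  apply/matrixP => n m; rewrite !mxE.
  have [r i] := orth n m.
  have E f g : (forall x, f x = g x) -> int_re g = ((n == m)%:R)%:E ->
      int_im g = 0%E -> cint f = (n == m)%:R :> complex R.
    move=> fg gr gi; have -> : f = g by apply/funext.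
    have -> : cint g = Complex (fine (int_re g)) (fine (int_im g)) by [].
    by rewrite gr gi; case: eqP.
  by apply: (E _ _ _ r i) => x; rewrite gramE.
have main := trace_cube_integral ia al_int phi_per phi_ac gram1 e_fin.
have iT := trace_cube_c_integrable phi_ac.
have -> : S = (\sum_n \sum_j \int[lebesgue_measure]_(x in `[0%R, (2 * pi)%R])
    cabs2 (magnetic_der a phi dphi n j x))%:E.
  rewrite SE -sumEFin; apply: eq_bigr => n _; rewrite -sumEFin; apply: eq_bigr => j _.
  exact: (esym (EFin_Rintegral (e_fin n j))).
rewrite -EFinM.
(* All energies being finite, the inequality reduces to the one between real-valued integrals. *)
apply: le_trans (_ : (_%:E <= _)%E); last by rewrite lee_fin; exact: main.
rewrite EFin_Rintegral//.
move: iT; rewrite /c_integrable /per_int => -[iT _].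
by apply: eq_integrable iT => // x _; rewrite /= trace_Umat_cube.
Qed.
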